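(* Let $\mathsf{Sys}^{\mathsf{ef}}$ be the category whose objects are the nontrivial dynamical systems and whose morphisms are embedding-factor pairs, and let $\mathsf{Sys}^{\mathsf{ef}}_{\mathsf{fin}}$ be its full subcategory consisting of the systems with finite state space. Then there is an object of $\mathsf{Sys}^{\mathsf{ef}}$, unique up to isomorphism in $\mathsf{Sys}^{\mathsf{ef}}$, that is $\mathsf{Sys}^{\mathsf{ef}}$-universal and $\mathsf{Sys}^{\mathsf{ef}}_{\mathsf{fin}}$-homogeneous.
   Context: Multifunctions. A multifunction $F:X\rightrightarrows Y$ assigns to each $x\in X$ a subset $F(x)\subseteq Y$; write $x\xrightarrow{F}y$ for $y\in F(x)$ and $F[A]=\bigcup_{x\in A}F(x)$; composition is $(G\circ F)(x)=G[F(x)]$; functions are identified with singleton-valued multifunctions. $F$ is total if every $F(x)\neq\emptyset$; partition-injective if $F(x)\cap F(x')=\emptyset$ for $x\neq x'$ and every $y\in Y$ lies in some $F(x)$; closed-valued if every $F(x)$ is closed; upper-hemicontinuous if for every $x$ and open $V\supseteq F(x)$ there is an open $U\ni x$ with $F(x')\subseteq V$ for all $x'\in U$. Dynamical systems. A dynamical system is a pair $(X,T)$ with $X$ a zero-dimensional (having a basis of clopen sets), second-countable, compact Hausdorff space and $T:X\rightrightarrows X$ a closed-valued, upper-hemicontinuous multifunction. It is nontrivial if $x\xrightarrow{T}x'$ for some $x,x'\in X$. Morphisms. A system morphism $\varphi:(X,T)\to(Y,S)$ is a closed-valued, upper-hemicontinuous multifunction $\varphi:X\rightrightarrows Y$ such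 that (1) if $x\xrightarrow{T}x'$, there are $y,y'$ with $x\xrightarrow{\varphi}y$, $x'\xrightarrow{\varphi}y'$, $y\xrightarrow{S}y'$; (2) if $y\xrightarrow{S}y'$, there are $x,x'$ with $x\xrightarrow{\varphi}y$, $x'\xrightarrow{\varphi}y'$, $x\xrightarrow{T}x'$. It is a factor if it is a surjective function and (3) whenever $x\xrightarrow{\varphi}y$ and $x\xrightarrow{T}x'$ there is $y'$ with $y\xrightarrow{S}y'$ and $x'\xrightarrow{\varphi}y'$. It is an embedding if it is total and partition-injective and (4) whenever $x\xrightarrow{\varphi}y$ and $y\xrightarrow{S}y'$ there is $x'$ with $x\xrightarrow{T}x'$ and $x'\xrightarrow{\varphi}y'$. An embedding-factor pair (ef-pair) $(e,f):(X,T)\to(Y,S)$ consists of an embedding $e:(X,T)\to(Y,S)$ and a factor $f:(Y,S)\to(X,T)$ with $f\circ e(x)=\{x\}$ for all $x\in X$ and $y\in e\circ f(y)$ for all $y\in Y$. Composition: $(e',f')\circ(e,f)=(e'\circ e,f\circ f')$. Universality and homogeneity. For a category $\mathsf{C}$ and a full subcategory $\mathsf{D}$, an object $U$ of $\mathsf{C}$ is $\mathsf{D}$-universal if for every object $A$ of $\mathsf{D}$ there is a morphism $A\to U$; it is $\mathsf{D}$-homogeneous if for every object $A$ of $\mathsf{D}$ and all morphisms $f,g:A\to U$ there is an isomorphism $h:U\to U$ with $h\circ g=f$. *)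

(* Defs.v *)
From HB Require Import structures.
From mathcomp Require Import all_boot.
From mathcomp Require Import boolp classical_sets cardinality topology.

Set Implicit Arguments.
Unset Strict Implicit.
Unset Printing Implicit Defensive.

Local Open Scope classical_set_scope.

Definition multifun (X Y : Type) := X -> set Y.

Section multifun.
Context {X Y Z : Type}.

Definition mimage (F : multifun X Y) (A : set X) : set Y := \bigcup_(x in A) F x.

Definition mcomp (G : multifun Y Z) (F : multifun X Y) : multifun X Z :=
  fun x => \bigcup_(y in F x) G y.

Definition mid : multifun X X := fun x => [set x].

Definition is_function (F : multifun X Y) :=
  exists f : X -> Y, F = (fun x => [set f x]).

Definition msurjective (F : multifun X Y) := mimage F setT = setT.

Definition total (F : multifun X Y) := forall x, F x !=set0.

(* Despite the name, this also asks the values to cover the codomain. *)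
Definition partition_injective (F : multifun X Y) :=
  (forall x x', x <> x' -> F x `&` F x' = set0) /\ (forall y, exists x, F x y).

End multifun.

Section multifun_topology.
Context {X Y : topologicalType}.

Definition closed_valued (F : multifun X Y) := forall x, closed (F x).

Definition upper_hemicontinuous (F : multifun X Y) :=
  forall (x : X) (V : set Y), open V -> F x `<=` V ->
    exists U : set X, [/\ open U, U x & forall x', U x' -> F x' `<=` V].

End multifun_topology.

(* The library's [zero_dimensional] only asks that clopen sets separate
   points. *)
Definition has_clopen_basis (X : topologicalType) :=
  exists2 B : set (set X), basis B & B `<=` clopen.

Record system := System {
  state :> topologicalType;
  step : multifun state state;
  system_clopen_basis : has_clopen_basis state;
  system_second_countable : @second_countable state;
  system_compact : compact [set: state];
  system_hausdorff : hausdorff_space state;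
  step_closed : closed_valued step;
  step_uhc : upper_hemicontinuous step }.

Arguments step : clear implicits.

Definition nontrivial (X : system) := exists x x' : X, step X x x'.

Section morphisms.
Context {X Y : system}.

Definition system_morphism (phi : multifun X Y) :=
  [/\ closed_valued phi,
      upper_hemicontinuous phi,
      (forall x x', step X x x' ->
         exists y y', [/\ phi x y, phi x' y' & step Y y y']) &
      (forall y y', step Y y y' ->
         exists x x', [/\ phi x y, phi x' y' & step X x x'])].

Definition is_factor (phi : multifun X Y) :=
  [/\ system_morphism phi, is_function phi, msurjective phi &
      (forall x x' y, phi x y -> step X x x' ->
         exists2 y', step Y y y' & phi x' y')].

Definition is_embedding (phi : multifun X Y) :=
  [/\ system_morphism phi, total phi, partition_injective phi &
      (forall x y y', phi x y -> step Y y y' ->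
         exists2 x', step X x x' & phi x' y')].

End morphisms.

Definition is_ef_pair {X Y : system} (p : multifun X Y * multifun Y X) :=
  [/\ is_embedding p.1, is_factor p.2,
      (forall x, mcomp p.2 p.1 x = [set x]) &
      (forall y, mcomp p.1 p.2 y y)].

Record category := Category {
  obj :> Type;
  hom : obj -> obj -> Type;
  idm : forall A, hom A A;
  comp : forall A B C, hom B C -> hom A B -> hom A C;
  comp_idl : forall A B (f : hom A B), comp (idm B) f = f;
  comp_idr : forall A B (f : hom A B), comp f (idm A) = f;
  compA : forall A B C D (h : hom C D) (g : hom B C) (f : hom A B),
    comp h (comp g f) = comp (comp h g) f }.

Section category_notions.
Context {C : category}.

Definition is_iso {A B : C} (f : hom A B) :=
  exists g : hom B A, comp g f = idm A /\ comp f g = idm B.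

Definition isomorphic (A B : C) := exists f : hom A B, is_iso f.

(* A full subcategory is given by the predicate [D] selecting its objects. *)
Definition universal (D : C -> Prop) (U : C) :=
  forall A : C, D A -> inhabited (hom A U).

Definition homogeneous (D : C -> Prop) (U : C) :=
  forall A : C, D A -> forall f g : hom A U,
    exists2 h : hom U U, is_iso h & comp h g = f.

End category_notions.

Section multifun_laws.
Context {X Y Z W : Type}.

Lemma mcomp_idl (F : multifun X Y) : mcomp mid F = F.
Proof.
apply/funext => x; apply/seteqP; split => y /=; first by move=> [z Fz /= ->].
by move=> Fy; exists y.
Qed.

Lemma mcomp_idr (F : multifun X Y) : mcomp F mid = F.
Proof.
apply/funext => x; apply/seteqP; split => y /=; first by move=> [z /= ->].
by move=> Fy; exists x.
Qed.

Lemma mcompA (H : multifun Z W) (G : multifun Y Z) (F : multifun X Y) :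
  mcomp H (mcomp G F) = mcomp (mcomp H G) F.
Proof.
apply/funext => x; apply/seteqP; split => w /=.
  by move=> [z [y Fy Gz] Hw]; exists y => //; exists z.
by move=> [y Fy [z Gz Hw]]; exists z => //; exists y.
Qed.

End multifun_laws.

Section composition.
Context {X Y Z : system}.
Implicit Types (F : multifun X Y) (G : multifun Y Z).

Lemma closed_valued_comp F G : closed_valued F -> closed_valued G ->
  upper_hemicontinuous G -> closed_valued (mcomp G F).
Proof.
move=> cF cG uG x; rewrite -[mcomp G F x]setCK; apply: open_closedC.
rewrite openE => z nGFz; rewrite /interior.
have /compact_near_coveringP cov : compact (F x).
  by apply: (subclosed_compact (cF x) (@system_compact Y)).
have : \forall w \near z, F x `<=` [set y | ~ G y w].
  apply: cov => y Fy.
  have nGz : ~ G y z by move=> Gz; apply: nGFz; exists y.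
  have [B [oB nB] clB] := system_clopen_basis Z.
  have /nB [W [BW Wz] /= WG] : nbhs z (~` G y).
    by apply: open_nbhs_nbhs; split => //; exact: closed_openC.
  have [oW cW] := clB _ BW.
  have [|U [oU Uy UW]] := uG y (~` W) (closed_openC cW).
    by move=> w Gw Ww; apply: (WG w).
  exists (U, W) => /=.
    by split; apply: open_nbhs_nbhs; split.
  by move=> [y' w] /= [Uy' Ww] Gw; apply: (UW _ Uy' _ Gw).
by apply: filterS => w Hw [y Fy Gw]; exact: (Hw y Fy Gw).
Qed.

Lemma uhc_comp F G : upper_hemicontinuous F -> upper_hemicontinuous G ->
  upper_hemicontinuous (mcomp G F).
Proof.
move=> uF uG x V oV GFV.
have [||U [oU Ux UF]] := uF x [set y | G y `<=` V]°.
- exact: open_interior.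
- move=> y Fy; rewrite /interior.
  have [|U [oU Uy UG]] := uG y V oV.
    by move=> z Gz; apply: GFV; exists y.
  by rewrite nbhsE; exists U.
exists U; split => // x' Ux' z [y Fy Gz].
exact: (interior_subset (UF x' Ux' y Fy)).
Qed.

Lemma system_morphism_comp F G : system_morphism F -> system_morphism G ->
  system_morphism (mcomp G F).
Proof.
move=> [cF uF F1 F2] [cG uG G1 G2]; split.
- exact: closed_valued_comp.
- exact: uhc_comp.
- move=> x x' /F1[y [y' [Fy Fy' /G1[z [z' [Gz Gz' zz']]]]]].
  by exists z, z'; split => //; [exists y|exists y'].
- move=> z z' /G2[y [y' [Gz Gz' /F2[x [x' [Fy Fy' xx']]]]]].
  by exists x, x'; split => //; [exists y|exists y'].
Qed.

Lemma embedding_comp F G : is_embedding F -> is_embedding G ->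
  is_embedding (mcomp G F).
Proof.
move=> [mF tF [dF pF] F4] [mG tG [dG pG] G4]; split.
- exact: system_morphism_comp.
- by move=> x; have [y Fy] := tF x; have [z Gz] := tG y; exists z, y.
- split=> [x x' xx'|z].
    rewrite -subset0 => z [[y Fy Gz] [y' Fy' Gz']].
    have yy' : y = y'.
      by apply: contrapT => /dG; rewrite -subset0 => /(_ z); exact.
    by have := dF _ _ xx'; rewrite -subset0 => /(_ y); apply; split=> //; rewrite yy'.
  by have [y Gz] := pG z; have [x Fy] := pF y; exists x, y.
- move=> x z z' [y Fy Gz] /(G4 _ _ _ Gz)[y' /(F4 _ _ _ Fy)[x' xx' Fy'] Gz'].
  by exists x' => //; exists y'.
Qed.

Lemma factor_comp F G : is_factor F -> is_factor G -> is_factor (mcomp G F).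
Proof.
move=> [mF [f fE] sF F3] [mG [g gE] sG G3]; split.
- exact: system_morphism_comp.
- exists (g \o f); rewrite fE gE; apply/funext => x.
  by rewrite /mcomp bigcup_set1.
- apply/seteqP; split => // z _.
  have [y _ Gz] : mimage G setT z by rewrite sG.
  have [x _ Fy] : mimage F setT y by rewrite sF.
  by exists x => //; exists y.
- move=> x x' z [y Fy Gz] /(F3 _ _ _ Fy)[y' /(G3 _ _ _ Gz)[z' zz' Gz'] Fy'].
  by exists z' => //; exists y'.
Qed.

End composition.

Lemma ef_pair_id (X : system) : is_ef_pair (mid, mid : multifun X X).
Proof.
have mm : system_morphism (mid : multifun X X).
  split.
  - move=> x; apply: accessible_closed_set1.
    exact: hausdorff_accessible (@system_hausdorff X).
  - move=> x V oV xV; exists V; split => //; first exact: xV.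
    by move=> x' Vx' _ ->.
  - by move=> x x' xx'; exists x, x'.
  - by move=> x x' xx'; exists x, x'.
split => /=.
- split=> //; first by move=> x; exists x.
    split=> [x x' xx'|y]; last by exists y.
    by rewrite -subset0 => y [/= -> ].
  by move=> x _ y' /= -> xy'; exists y'.
- split=> //; first by exists id.
    by apply/seteqP; split => // y _; exists y.
  by move=> x x' _ /= -> xx'; exists x'.
- by move=> x; rewrite mcomp_idl.
- by move=> x; rewrite mcomp_idl.
Qed.

Definition ef_comp {X Y Z : system}
    (q : multifun Y Z * multifun Z Y) (p : multifun X Y * multifun Y X) :
    multifun X Z * multifun Z X :=
  (mcomp q.1 p.1, mcomp p.2 q.2).

Lemma ef_pair_comp (X Y Z : system)
    (q : multifun Y Z * multifun Z Y) (p : multifun X Y * multifun Y X) :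
  is_ef_pair q -> is_ef_pair p -> is_ef_pair (ef_comp q p).
Proof.
case: q p => [e' f'] [e f] [/= me' mf' fe' ef'] [/= me mf fe ef].
split => /=.
- exact: embedding_comp.
- exact: factor_comp.
- move=> x; rewrite -mcompA [mcomp f' _]mcompA.
  have -> : mcomp f' e' = mid by apply/funext.
  by rewrite mcomp_idl.
- move=> z; have [y f'z e'y] := ef' z; have [x fy ex] := ef y.
  by exists x; [exists y|exists y].
Qed.

Definition nontrivial_system := {X : system | nontrivial X}.

Definition ef_hom (X Y : nontrivial_system) :=
  {p : multifun (sval X) (sval Y) * multifun (sval Y) (sval X) | is_ef_pair p}.

Definition ef_hom_id (X : nontrivial_system) : ef_hom X X :=
  exist _ _ (ef_pair_id (sval X)).

Definition ef_hom_comp (X Y Z : nontrivial_system)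
    (q : ef_hom Y Z) (p : ef_hom X Y) : ef_hom X Z :=
  exist _ _ (ef_pair_comp (svalP q) (svalP p)).

Lemma ef_hom_eq (X Y : nontrivial_system) (p q : ef_hom X Y) :
  sval p = sval q -> p = q.
Proof. by move: p q => [p hp] [q hq] /= pq; exact: eq_exist. Qed.

Lemma ef_hom_idl (X Y : nontrivial_system) (p : ef_hom X Y) :
  ef_hom_comp (ef_hom_id Y) p = p.
Proof.
by apply: ef_hom_eq; rewrite /= /ef_comp mcomp_idl mcomp_idr -surjective_pairing.
Qed.

Lemma ef_hom_idr (X Y : nontrivial_system) (p : ef_hom X Y) :
  ef_hom_comp p (ef_hom_id X) = p.
Proof.
by apply: ef_hom_eq; rewrite /= /ef_comp mcomp_idl mcomp_idr -surjective_pairing.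
Qed.

Lemma ef_hom_compA (X Y Z W : nontrivial_system)
    (r : ef_hom Z W) (q : ef_hom Y Z) (p : ef_hom X Y) :
  ef_hom_comp r (ef_hom_comp q p) = ef_hom_comp (ef_hom_comp r q) p.
Proof. by apply: ef_hom_eq; rewrite /= /ef_comp /= !mcompA. Qed.

Definition Sys_ef : category :=
  Category ef_hom_idl ef_hom_idr ef_hom_compA.

Definition all_systems (X : Sys_ef) : Prop := True.

Definition finite_systems (X : Sys_ef) : Prop :=
  finite_set [set: state (sval X)].

(* Main.v *)
From HB Require Import structures.
From mathcomp Require Import all_boot.
From mathcomp Require Import boolp classical_sets cardinality topology cantor.
Require Import Defs.

Set Implicit Arguments.
Unset Strict Implicit.
Unset Printing Implicit Defensive.

Local Open Scope classical_set_scope.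

(* An ef-pair (e, f) from X to Y satisfies e = f^-1, so it amounts to a
   continuous surjection f from Y to X that maps the relation of Y onto that of
   X.  The theorem thus asks for the projective Fraisse limit of the finite
   directed graphs with at least one edge.  It is characterized by a
   one-step lifting property (extensible), from which universality,
   homogeneity and uniqueness follow by (back-and-)forth along sequences of
   finite clopen partitions and a compactness argument.  The limit itself is
   explicit: in any model, refining partitions shows that no point lies on two
   edges and that the set of endpoints is nowhere dense, so the relation is a
   homeomorphism between two disjoint nowhere dense Cantor subsets of the
   Cantor space. *)

(** * Compactness and finite clopen partitions *)

Lemma compact_nested (Z : topologicalType) (D : nat -> set Z) :
  compact [set: Z] -> (forall n, closed (D n)) ->
  (forall n, D n.+1 `<=` D n) -> (forall n, D n !=set0) ->
  exists z, forall n, D n z.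
Proof.
move=> cZ clD decD D0.
have mono m n : m <= n -> D n `<=` D m.
  elim: n => [|n IH]; first by rewrite leqn0 => /eqP ->.
  rewrite leq_eqVlt => /predU1P[-> //|]; rewrite ltnS => /IH.
  exact: subset_trans.
have [] := cZ (filter_from setT D).
- apply: filter_from_proper => [|n _]; last exact: D0.
  apply: filter_from_filter; first by exists 0.
  move=> m n _ _; exists (maxn m n) => // z Dz.
  by split; apply: mono Dz; rewrite ?leq_maxl ?leq_maxr.
- by exists 0.
- move=> z [_ clz]; exists z => n; apply: clD => B nB.
  by apply: clz => //; exists n.
Qed.

(** A point [y] outside the closed set [step X x] has a clopen neighborhood [W] missing it, and
    upper hemicontinuity keeps the successors of points near [x] off [W]. Closedness of the whole
    graph lets edges pass to limits. *)
Lemma closed_step (X : system) : closed [set p : X * X | step X p.1 p.2].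
Proof.
rewrite -openC openE => -[x y] /= nxy.
have [B [oB nB] clB] := system_clopen_basis X.
have /nB [W [BW Wy] /= WT] : nbhs y (~` step X x).
  by apply: open_nbhs_nbhs; split => //; exact/closed_openC/step_closed.
have [oW cW] := clB _ BW.
have [|V [oV Vx VW]] := @step_uhc X x (~` W) (closed_openC cW).
  by move=> z xz Wz; exact: (WT z).
exists (V, W); first by split; exact: open_nbhs_nbhs.
by move=> [x' y'] /= [Vx' Wy'] /(VW _ Vx').
Qed.

(* Labelled finite clopen partitions, finiteness being automatic on compact
   spaces (coloring_bounded). *)
Definition coloring (X : topologicalType) (c : X -> nat) :=
  forall n, open [set x | c x = n].

Lemma half_double_bit n (b : bool) : (n.*2 + b)./2 = n.
Proof. by rewrite addnC half_bit_double. Qed.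

(** The membership bit is stored as the lowest binary digit, so that [half] forgets it and is the
    refinement map at every stage. *)
Definition split_color (X : Type) (W : set X) (c : X -> nat) : X -> nat :=
  fun x => (c x).*2 + `[< W x >].

Lemma half_split_color (X : Type) (W : set X) c x :
  (split_color W c x)./2 = c x.
Proof. exact: half_double_bit. Qed.

Lemma split_colorP (X : Type) (W : set X) c x y :
  split_color W c x = split_color W c y -> W x <-> W y.
Proof.
move=> /(congr1 odd); rewrite /split_color !oddD !odd_double /= !oddb => e.
by split=> ?; apply/asboolP; [rewrite -e|rewrite e]; apply/asboolP.
Qed.

Section coloring.
Context {X : topologicalType}.
Implicit Types c d : X -> nat.

Lemma coloring_open c (P : set nat) : coloring c -> open [set x | P (c x)].
Proof.
move=> cc; have -> : [set x | P (c x)] = \bigcup_(n in P) [set x | c x = n].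
  by apply/seteqP; split => [x Px|x [n Pn /= ->]//]; exists (c x).
by apply: bigcup_open => n _; exact: cc.
Qed.

Lemma coloring_closed c (P : set nat) : coloring c -> closed [set x | P (c x)].
Proof. by move=> cc; rewrite -openC; exact: (@coloring_open c (~` P)). Qed.

Lemma coloring_comp c (g : nat -> nat) : coloring c -> coloring (g \o c).
Proof. by move=> cc n; exact: (@coloring_open c [set m | g m = n]). Qed.

Lemma coloring_split c (W : set X) : coloring c -> clopen W ->
  coloring (split_color W c).
Proof.
move=> cc [oW cW] n.
have -> : [set x | split_color W c x = n] =
    W `&` [set x | (c x).*2.+1 = n] `|` ~` W `&` [set x | (c x).*2 = n].
  rewrite /split_color; apply/seteqP; split => x /=.
    by case: asboolP => Wx; rewrite ?addn1 ?addn0; [left|right].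
  by move=> [] [Wx <-]; rewrite ?(asboolT Wx) ?(asboolF Wx) ?addn1 ?addn0.
apply: openU; apply: openI => //; last 2 first.
- by rewrite openC.
- exact: (@coloring_open c [set m | m.*2 = n]).
- exact: (@coloring_open c [set m | m.*2.+1 = n]).
Qed.

(** The closed sets [n <= c x] decrease to the empty set, so one of them is empty. *)
Lemma coloring_bounded c : compact [set: X] -> coloring c ->
  exists N, forall x, c x < N.
Proof.
move=> cX cc; apply: contrapT => nb.
have [|||x /(_ (c x).+1) /=] :=
  @compact_nested X (fun n => [set x | n <= c x]) cX.
- by move=> n; exact: (@coloring_closed c [set m | n <= m]).
- by move=> n x /=; exact: ltnW.
- move=> n; apply: contrapT => /set0P/negP; rewrite negbK => /eqP e.
  apply: nb; exists n => x; rewrite ltnNge; apply/negP => nx.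
  by have : [set x | n <= c x] x := nx; rewrite e.
- by rewrite ltnn.
Qed.

End coloring.

Lemma coloring_fun (X Y : topologicalType) (f : X -> Y) (c : Y -> nat) :
  continuous f -> coloring c -> coloring (c \o f).
Proof. by move=> /continuousP cf cc n; exact: cf (cc n). Qed.

Definition edge_color (X : system) (c : X -> nat) a b :=
  exists x x', [/\ c x = a, c x' = b & step X x x'].

(** The labelled quotient graphs are equal, not merely isomorphic, so no isomorphism between them
    has to be carried along. *)
Definition similar (X Y : system) (c : X -> nat) (d : Y -> nat) :=
  range c = range d /\ edge_color c = edge_color d.

Lemma similar_sym (X Y : system) (c : X -> nat) (d : Y -> nat) :
  similar c d -> similar d c.
Proof. by case. Qed.

Lemma similar_trans (X Y Z : system) (c : X -> nat) (d : Y -> nat)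
    (e : Z -> nat) : similar c d -> similar d e -> similar c e.
Proof. by move=> [cd cd'] [de de']; split; [rewrite cd|rewrite cd']. Qed.

(** * Embedding-factor pairs as quotient maps *)

Definition quotient_map (Y X : system) (F : Y -> X) :=
  [/\ continuous F,
      (forall x, exists y, F y = x),
      (forall y y', step Y y y' -> step X (F y) (F y')) &
      (forall x x', step X x x' ->
         exists y y', [/\ F y = x, F y' = x' & step Y y y'])].

Lemma quotient_map_comp (Z Y X : system) (G : Z -> Y) (F : Y -> X) :
  quotient_map G -> quotient_map F -> quotient_map (F \o G).
Proof.
move=> [cG sG hG lG] [cF sF hF lF]; split.
- by move=> z; apply: continuous_comp; [exact: cG|exact: cF].
- by move=> x; have [y <-] := sF x; have [z <-] := sG y; exists z.
- by move=> z z' /hG/hF.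
- by move=> x x' /lF[y [y' [<- <- /lG[z [z' [<- <- ?]]]]]]; exists z, z'.
Qed.

Lemma quotient_similar (Y X : system) (F : Y -> X) (c : X -> nat) :
  quotient_map F -> similar (c \o F) c.
Proof.
move=> [_ sF hF lF]; split.
  apply/seteqP; split => n [y _ <-]; first by exists (F y).
  by have [z <-] := sF y; exists z.
apply/funext => a; apply/funext => b; apply/propext; split.
  by move=> [y [y' [<- <- /hF]]]; exists (F y), (F y').
by move=> [x [x' [<- <- /lF[y [y' [<- <- ?]]]]]]; exists y, y'.
Qed.

Definition graph_pair (X Y : Type) (F : Y -> X) :
    multifun X Y * multifun Y X :=
  (fun x => [set y | F y = x], fun y => [set F y]).

Lemma graph_pair_inj (X Y : Type) : injective (@graph_pair X Y).
Proof.
move=> F G [_ FG]; apply/funext => y.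
by have : [set F y] (F y) by []; rewrite (congr1 (@^~ y) FG : [set F y] = [set G y]).
Qed.

Lemma graph_pair_comp (X Y Z : system) (G : Z -> Y) (F : Y -> X) :
  ef_comp (graph_pair G) (graph_pair F) = graph_pair (F \o G).
Proof.
congr pair; apply/funext => x; apply/seteqP; split => y /=.
- by move=> [z /= <- <-].
- by move=> <-; exists (G y).
- by move=> [z /= -> ->].
- by move=> ->; exists (G x).
Qed.

Lemma graph_pair_ef (Y X : system) (F : Y -> X) :
  quotient_map F -> is_ef_pair (graph_pair F).
Proof.
move=> [cF sF hF lF].
have oF : forall V : set X, open V -> open (F @^-1` V) by apply/continuousP.
have cl1 x : closed [set x : X].
  apply: accessible_closed_set1.
  exact: hausdorff_accessible (@system_hausdorff X).
split => /=.
- split.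
  + split.
    * move=> x; rewrite -openC; exact: oF (closed_openC (cl1 x)).
    * move=> x V oV FV.
      (* Upper hemicontinuity of the fibers amounts to [F] being a closed map: the points outside
         this image are those whose fiber lies in [V]. *)
      have cC : closed (F @` (~` V)).
        apply: compact_closed; first exact: system_hausdorff.
        apply: continuous_compact; first exact: continuous_subspaceT.
        apply: (subclosed_compact _ (@system_compact Y)) => //.
        exact: open_closedC.
      exists (~` (F @` (~` V))); split; first exact: closed_openC.
        by move=> [y nVy /FV].
      by move=> x' nx' y /= yx'; apply: contrapT => nVy; apply: nx'; exists y.
    * by move=> x x' /lF[y [y' [? ? ?]]]; exists y, y'.
    * by move=> y y' /hF; exists (F y), (F y').
  + by move=> x; have [y] := sF x; exists y.
  + split=> [x x' xx'|y]; last by exists (F y).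
    by rewrite -subset0 => y [/= -> ].
  + by move=> x y y' /= <- /hF; exists (F y').
- split.
  + split.
    * by move=> y; exact: cl1.
    * move=> y V oV yV; exists (F @^-1` V); split; [exact: oF|exact: yV|].
      by move=> y' Vy' _ ->.
    * by move=> y y' /hF; exists (F y), (F y').
    * by move=> x x' /lF[y [y' [? ? ?]]]; exists y, y'.
  + by exists F.
  + apply/seteqP; split => // x _; have [y <-] := sF x; by exists y.
  + by move=> y y' x /= -> /hF; exists (F y').
- move=> x; apply/seteqP; split => x' /=; first by move=> [y /= -> ->].
  by move=> ->; have [y Fy] := sF x; exists y.
- by move=> y; exists (F y).
Qed.

(** The two round-trip conditions give the two inclusions between [e x] and the fiber of [F] over
    [x]. Condition (1) for [f] says that [F] preserves edges, and for [e] that edges lift. *)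
Lemma ef_pair_graph (X Y : system) (p : multifun X Y * multifun Y X) :
  is_ef_pair p -> exists2 F, quotient_map F & p = graph_pair F.
Proof.
case: p => e f.
move=> [/= [[_ _ e1 _] te _ _] [[_ uf f1 _] [F fE] _ _] fe ef].
have {}fE y : f y = [set F y] by rewrite fE.
have eF x y : e x y -> F y = x.
  move=> exy; suff : [set x] (F y) by [].
  by rewrite -fe; exists y => //; rewrite fE.
have Fe y : e (F y) y by have [x] := ef y; rewrite fE => /= ->.
exists F; last first.
  congr pair; apply/funext => x; last exact: fE.
  by apply/seteqP; split => y /= => [/eF //|<-].
split.
- apply/continuousP => V oV; rewrite openE => y /= VFy; rewrite /interior nbhsE.
  have [|U [oU Uy UV]] := uf y V oV; first by rewrite fE => _ ->.
  by exists U => // z Uz; apply: (UV z Uz); rewrite fE.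
- by move=> x; have [y /eF] := te x; exists y.
- by move=> y y' /f1[x [x' []]]; rewrite !fE => /= -> ->.
- by move=> x x' /e1[y [y' [/eF ? /eF ? ?]]]; exists y, y'.
Qed.

Definition quotient_hom (X Y : Sys_ef) (F : state (sval Y) -> state (sval X))
    (qF : quotient_map F) : hom X Y :=
  exist _ (graph_pair F) (graph_pair_ef qF).

Lemma quotient_homP (X Y : Sys_ef) (p : hom X Y) :
  exists F (qF : quotient_map F), p = quotient_hom qF.
Proof.
have [F qF e] := ef_pair_graph (svalP p).
by exists F, qF; exact: ef_hom_eq.
Qed.

Lemma quotient_hom_comp (X Y Z : Sys_ef)
    (G : state (sval Z) -> state (sval Y)) (F : state (sval Y) -> state (sval X))
    (qG : quotient_map G) (qF : quotient_map F) :
  comp (quotient_hom qG) (quotient_hom qF) =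
  quotient_hom (quotient_map_comp qG qF).
Proof. by apply: ef_hom_eq; exact: graph_pair_comp. Qed.

Lemma eq_quotient_hom (X Y : Sys_ef) (F G : state (sval Y) -> state (sval X))
    (qF : quotient_map F) (qG : quotient_map G) :
  F =1 G <-> quotient_hom qF = quotient_hom qG.
Proof.
split=> [FG|e]; last by rewrite (graph_pair_inj (congr1 sval e)).
by apply: ef_hom_eq; congr graph_pair; exact: funext.
Qed.

Lemma is_iso_quotient (X Y : Sys_ef) (F : state (sval Y) -> state (sval X))
    (G : state (sval X) -> state (sval Y))
    (qF : quotient_map F) (qG : quotient_map G) :
  cancel F G -> cancel G F -> is_iso (quotient_hom qF).
Proof.
move=> FK GK; exists (quotient_hom qG); split; apply: ef_hom_eq.
  rewrite /= graph_pair_comp; congr pair; apply/funext => x;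
    by apply/seteqP; split => y /=; rewrite GK.
rewrite /= graph_pair_comp; congr pair; apply/funext => x;
  by apply/seteqP; split => y /=; rewrite FK.
Qed.

(** * Limits of sequences of colorings *)

Lemma sequence_choice (T : Type) (P : nat -> T -> Prop)
    (R : nat -> T -> T -> Prop) (x0 : T) : P 0 x0 ->
  (forall n x, P n x -> exists2 y, P n.+1 y & R n x y) ->
  exists f : nat -> T,
    [/\ f 0 = x0, forall n, P n (f n) & forall n, R n (f n) (f n.+1)].
Proof.
move=> P0 step.
have /choice[g gP] : forall nx : nat * T, exists y,
    P nx.1 nx.2 -> P nx.1.+1 y /\ R nx.1 nx.2 y.
  move=> [n x]; have [/step[y Py Rxy]|nP] := pselect (P n x); last by exists x.
  by exists y.
pose f := nat_rect (fun=> T) x0 (fun n x => g (n, x)).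
have Pf n : P n (f n) by elim: n => [//|n /(gP (n, f n))[]].
by exists f; split => // n; have [] := gP (n, f n) (Pf n).
Qed.

(** Pairs of basic open sets are countably many; for each pair that some clopen set separates, one
    such set is chosen. Any two distinct points have neighborhoods forming such a pair. *)
Lemma separating_clopens (X : system) : exists W : nat -> set X,
  (forall n, clopen (W n)) /\ forall x y, (forall n, W n x <-> W n y) -> x = y.
Proof.
have [A /countable_injP[f finj] [oA nA]] := @system_second_countable X.
have [B [oB nB] clB] := system_clopen_basis X.
pose sep (n : nat) (W : set X) := exists U V, [/\ A U, A V,
  unpickle n = Some (f U, f V), U `<=` W & V `<=` ~` W].
have /choice[W WP] : forall n, exists W : set X,
    clopen W /\ ((exists2 W', clopen W' & sep n W') -> sep n W).
  (* When [n] codes no separable pair, the empty set serves as a harmless default. *)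
  move=> n; have [[W cW sW]|nW] := pselect (exists2 W', clopen W' & sep n W').
    by exists W.
  by exists set0; split => //; exact: clopen0.
exists W; split => [n|x y Wxy]; first by have [] := WP n.
apply: contrapT => xy.
have /nB [C [BC Cx] /= Cy] : nbhs x (~` [set y]).
  apply: open_nbhs_nbhs; split => //; apply: closed_openC.
  apply: accessible_closed_set1.
  exact: hausdorff_accessible (@system_hausdorff X).
have cC := clB _ BC.
have /nA [U [AU Ux] /= UC] : nbhs x C by apply: open_nbhs_nbhs; case: cC.
have /nA [V [AV Vy] /= VC] : nbhs y (~` C).
  apply: open_nbhs_nbhs; split; first by apply: closed_openC; case: cC.
  by move=> /Cy; exact.
pose n := pickle (f U, f V).
have [|U' [V' [AU' AV' + U'W V'W]]] := (WP n).2.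
  by exists C => //; exists U, V; rewrite pickleK.
rewrite pickleK => -[/finj UU' /finj VV'].
have Wx : W n x by apply: U'W; rewrite -UU' ?inE.
have : V' y by rewrite -VV' ?inE.
by move=> /V'W; apply; apply/Wxy.
Qed.

Section limit.
Context {U V : system} (g : nat -> nat).
Variables (c : nat -> U -> nat) (d : nat -> V -> nat).
Hypotheses (colc : forall n, coloring (c n)) (cold : forall n, coloring (d n)).
Hypotheses (cg : forall n u, g (c n.+1 u) = c n u).
Hypotheses (dg : forall n v, g (d n.+1 v) = d n v).
Hypothesis cd : forall n, similar (c n) (d n).

(** The constraints are nested because [g] recovers each level from the next, and each is
    satisfiable because the ranges agree. *)
Lemma limit_point u : exists v, forall n, d n v = c n u.
Proof.
apply: (@compact_nested V (fun n => [set v | d n v = c n u])).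
- exact: system_compact.
- by move=> n; exact: (@coloring_closed V (d n) [set m | m = c n u]).
- by move=> n v /= e; rewrite -cg -dg e.
- move=> n; have : range (c n) (c n u) by exists u.
  by rewrite (cd n).1 => -[v _ dv]; exists v.
Qed.

(** The same compactness argument in [V * V], intersected with the closed graph of the relation;
    equality of edge colors makes every level nonempty. *)
Lemma limit_edge u u' : step U u u' -> exists v v',
  [/\ forall n, d n v = c n u, forall n, d n v' = c n u' & step V v v'].
Proof.
move=> uu'; have [||||[v v'] vP] := @compact_nested (V * V)%type (fun n =>
    [set p | d n p.1 = c n u] `&` [set p | d n p.2 = c n u'] `&`
    [set p | step V p.1 p.2]).
- by rewrite -setXTT; apply: compact_setX; exact: system_compact.
- move=> n; apply: closedI; last exact: closed_step.
  apply: closedI.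
  + apply: (@preimage_closed _ _ fst [set v | d n v = c n u]).
      by move=> p _; exact: cvg_fst.
    exact: (@coloring_closed V (d n) [set m | m = c n u]).
  + apply: (@preimage_closed _ _ snd [set v | d n v = c n u']).
      by move=> p _; exact: cvg_snd.
    exact: (@coloring_closed V (d n) [set m | m = c n u']).
- move=> n [v v'] /= [[e e'] ?]; split => //; split.
  + by rewrite /= -(cg n u) -(dg n v) e.
  + by rewrite /= -(cg n u') -(dg n v') e'.
- move=> n; have : edge_color (c n) (c n u) (c n u') by exists u, u'.
  by rewrite (cd n).2 => -[v [v' [? ? ?]]]; exists (v, v').
- exists v, v'; split => [n|n|]; last by have [] := vP 0.
  + by have [[]] := vP n.
  + by have [[]] := vP n.
Qed.

End limit.

(** [F u] is the unique point with the color sequence of [u]. Exchanging the roles of [U] and [V] in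
    the limit lemmas gives surjectivity and lifting of edges. *)
Lemma limit_quotient (U V : system) (g : nat -> nat)
    (c : nat -> U -> nat) (d : nat -> V -> nat) :
  (forall n, coloring (c n)) -> (forall n, coloring (d n)) ->
  (forall n u, g (c n.+1 u) = c n u) -> (forall n v, g (d n.+1 v) = d n v) ->
  (forall n, similar (c n) (d n)) ->
  (forall v v', (forall n, d n v = d n v') -> v = v') ->
  exists2 F : U -> V, quotient_map F & forall n u, d n (F u) = c n u.
Proof.
move=> colc cold cg dg cd sep.
have dc n : similar (d n) (c n) by exact: similar_sym.
have [F FP] := choice (limit_point cold cg dg cd).
have FE u v : (forall n, d n v = c n u) -> F u = v.
  by move=> uv; apply: sep => n; rewrite FP uv.
exists F => //; split.
- apply/continuousP => O oO; rewrite openE => u /= OFu.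
  (* These color classes shrink to the point [F u], so by compactness one of them fits into [O]. *)
  have [n nO] : exists n, [set v | d n v = c n u] `<=` O.
    apply: contrapT => nO.
    have [|||v vP] := @compact_nested V
        (fun n => [set v | d n v = c n u] `&` ~` O) (@system_compact V).
    + move=> n; apply: closedI; last exact: open_closedC.
      exact: (@coloring_closed V (d n) [set m | m = c n u]).
    + by move=> n v /= [e ?]; split => //; rewrite -cg -dg e.
    + move=> n; apply: contrapT => emp; apply: nO; exists n => v dv.
      by apply: contrapT => Ov; apply: emp; exists v.
    + have /FE e : forall n, d n v = c n u by move=> n; have [] := vP n.
      by have [_] := vP 0; rewrite -e.
  rewrite /interior nbhsE; exists [set u' | c n u' = c n u].
    by split => //; exact: colc.
  by move=> u' /= u'u; apply: nO; rewrite /= FP.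
- by move=> v; have [u uv] := limit_point colc dg cg dc v; exists u; exact: FE.
- move=> u u' /(limit_edge cold cg dg cd)[v [v' [uv u'v' vv']]].
  by rewrite (FE _ _ uv) (FE _ _ u'v').
- move=> v v' /(limit_edge colc dg cg dc)[u [u' [uv u'v' uu']]].
  by exists u, u'; split => //; exact: FE.
Qed.

(** * Extensible systems *)

(* With half as refinement map, each vertex of a finite quotient splits into at
   most two; such refinements are cofinal. *)
Definition extensible (U : system) :=
  forall (X : system) (c : U -> nat) (d : X -> nat),
    coloring c -> coloring d -> similar c (half \o d) ->
    exists e : U -> nat,
      [/\ coloring e, similar e d & forall u, (e u)./2 = c u].

(** By nontriviality both one-color quotients are a single vertex with a loop. This is the initial
    stage for universality and uniqueness. *)
Lemma similar_const (X Y : system) (a : nat) : nontrivial X -> nontrivial Y ->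
  similar (fun _ : X => a) (fun _ : Y => a).
Proof.
move=> [x [x' xx']] [y [y' yy']]; split.
  by apply/seteqP; split => _ [_ _ <-]; [exists y|exists x].
apply/funext => b; apply/funext => b'; apply/propext.
by split=> -[_ [_ [<- <- _]]]; [exists y, y'|exists x, x'].
Qed.

Lemma coloring_const (X : topologicalType) (a : nat) :
  coloring (fun _ : X => a).
Proof.
move=> n; case: (pselect (a = n)) => e.
  by rewrite (_ : mkset _ = setT) //; [exact: openT|apply/seteqP; split].
by rewrite (_ : mkset _ = set0) //; [exact: open0|apply/seteqP; split].
Qed.

(** Only the forth direction: [d n] records the first [n] separating clopen sets of [X], and
    extensibility copies each refinement to [U]. *)
Lemma extensible_quotient (U X : system) :
  extensible U -> nontrivial U -> nontrivial X ->
  exists F : U -> X, quotient_map F.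
Proof.
move=> eU ntU ntX; have [W [cW sepW]] := separating_clopens X.
pose d := nat_rect (fun=> X -> nat) (fun=> 0) (fun n => split_color (W n)).
have cold n : coloring (d n).
  by elim: n => [|n IH]; [exact: coloring_const|exact: coloring_split].
have dS n x : (d n.+1 x)./2 = d n x by exact: half_split_color.
have [||c [_ cP cS]] := @sequence_choice (U -> nat)
    (fun n c => coloring c /\ similar c (d n))
    (fun n c c' => forall u, (c' u)./2 = c u) (fun=> 0).
- by split; [exact: coloring_const|exact: similar_const].
- move=> n c [colc cd].
  have [|e [cole ed ec]] := eU X c (d n.+1) colc (cold _).
    by rewrite (_ : half \o _ = d n) //; apply/funext => x; exact: dS.
  by exists e.
have [] := @limit_quotient U X half c d.
- by move=> n; have [] := cP n.
- by [].
- by [].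
- by [].
- by move=> n; have [] := cP n.
- move=> x y xy; apply: sepW => n; exact: split_colorP (xy n.+1).
- by move=> F qF _; exists F.
Qed.

(** Back-and-forth: each round splits the coloring of [U] by [WU n] and copies this to [V], then
    splits by [WV n] and copies back. Both color sequences end up separating points, so the two
    limit maps are mutually inverse. *)
Lemma extensible_iso (U V : system) (c : U -> nat) (d : V -> nat) :
  extensible U -> extensible V -> coloring c -> coloring d -> similar c d ->
  exists (F : U -> V) (G : V -> U), [/\ quotient_map F, quotient_map G,
    cancel F G, cancel G F & forall u, d (F u) = c u].
Proof.
move=> eU eV colc cold cd.
have [WU [clU sepU]] := separating_clopens U.
have [WV [clV sepV]] := separating_clopens V.
(* One round refines each side twice, hence the two halvings. *)
pose R n (p q : (U -> nat) * (V -> nat)) :=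
  [/\ forall u, (q.1 u)./2./2 = p.1 u, forall v, (q.2 v)./2./2 = p.2 v,
      forall u u', q.1 u = q.1 u' -> WU n u <-> WU n u' &
      forall v v', q.2 v = q.2 v' -> WV n v <-> WV n v'].
have [||f [f0 fP fR]] := @sequence_choice _ (fun _ p =>
    [/\ coloring p.1, coloring p.2 & similar p.1 p.2]) R (c, d).
- by [].
- move=> n [c1 d1] /= [col1 col2 sim].
  have colc2 := coloring_split col1 (clU n).
  have [|d2 [cold2 sim2 d2P]] := eV U d1 _ col2 colc2.
    apply: similar_sym; rewrite (_ : half \o _ = c1) //.
    by apply/funext => u; exact: half_split_color.
  have cold3 := coloring_split cold2 (clV n).
  have [|c3 [colc3 sim3 c3P]] := eU V _ _ colc2 cold3.
    apply: similar_sym; rewrite (_ : half \o _ = d2) //.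
    by apply/funext => v; exact: half_split_color.
  exists (c3, split_color (WV n) d2) => //; split => /=.
  + by move=> u; rewrite c3P half_split_color.
  + by move=> v; rewrite half_split_color.
  + move=> u u' /(congr1 half); rewrite !c3P; exact: split_colorP.
  + by move=> v v'; exact: split_colorP.
have col1 n : coloring (f n).1 by have [] := fP n.
have col2 n : coloring (f n).2 by have [] := fP n.
have sim n : similar (f n).1 (f n).2 by have [] := fP n.
have f1 n u : ((f n.+1).1 u)./2./2 = (f n).1 u by have [] := fR n.
have f2 n v : ((f n.+1).2 v)./2./2 = (f n).2 v by have [] := fR n.
have sep1 u u' : (forall n, (f n).1 u = (f n).1 u') -> u = u'.
  by move=> e; apply: sepU => n; have [_ _ + _] := fR n; apply.
have sep2 v v' : (forall n, (f n).2 v = (f n).2 v') -> v = v'.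
  by move=> e; apply: sepV => n; have [_ _ _] := fR n; apply.
have [F qF FP] := limit_quotient (g := half \o half) col1 col2 f1 f2 sim sep2.
have [G qG GP] := limit_quotient (g := half \o half) col2 col1 f2 f1
  (fun n => similar_sym (sim n)) sep1.
exists F, G; split => //.
- by move=> u; apply: sep1 => n; rewrite GP FP.
- by move=> v; apply: sep2 => n; rewrite FP GP.
- by move=> u; have := FP 0 u; rewrite f0.
Qed.

(** * Finite quotient systems *)

Section color_system.
Variables (N : nat) (A : set nat) (E : nat -> nat -> Prop).

Definition color_state := discrete_topology {i : 'I_N | `[< A i >]}.

Definition color_val (x : color_state) : nat :=
  val (val (x : {i : 'I_N | `[< A i >]})).

Definition color_step : multifun color_state color_state :=
  fun x => [set y | E (color_val x) (color_val y)].

Lemma color_state_finite : finite_set [set: color_state].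
Proof. exact: (@finite_finset {i : 'I_N | `[< A i >]}). Qed.

Lemma color_basis : basis (range (@set1 color_state)).
Proof.
split=> [_ [x _ <-]|x O Ox]; first exact: discrete_open.
by exists [set x]; [split => //; exists x|move=> _ /= ->; exact: nbhs_singleton].
Qed.

Lemma color_clopen_basis : has_clopen_basis color_state.
Proof.
exists (range (@set1 color_state)); first exact: color_basis.
by move=> _ [x _ <-]; split; [exact: discrete_open|exact: discrete_closed].
Qed.

Lemma color_second_countable : @second_countable color_state.
Proof.
exists (range (@set1 color_state)); last exact: color_basis.
by apply: finite_set_countable; apply: finite_image; exact: color_state_finite.
Qed.

Lemma color_step_closed : closed_valued color_step.
Proof. by move=> x; exact: discrete_closed. Qed.

Lemma color_step_uhc : upper_hemicontinuous color_step.
Proof.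
move=> x V _ xV; exists [set x]; split => //; first exact: discrete_open.
by move=> _ ->.
Qed.

Definition color_system : system :=
  System color_clopen_basis color_second_countable
    (finite_compact color_state_finite) discrete_hausdorff
    color_step_closed color_step_uhc.

Definition color_of (x : color_system) : nat := color_val x.

Lemma color_of_inj : injective color_of.
Proof. by move=> x y xy; apply/val_inj/val_inj. Qed.

Lemma coloring_color_of : coloring color_of.
Proof. by move=> n; exact: (@discrete_open (color_state)). Qed.

End color_system.
Arguments color_of {N A E}.

(** [A] and [E] are tied to [c] only by equations, so that similar colorings of different systems
    map onto one and the same finite system. *)
Lemma color_system_quotient (X : system) (c : X -> nat) (N : nat)
    (A : set nat) (E : nat -> nat -> Prop) :
  coloring c -> (forall x, c x < N) -> range c = A -> edge_color c = E ->
  exists2 F : X -> color_system N A E,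
    quotient_map F & forall x, color_of (F x) = c x.
Proof.
move=> cc cN <- <-.
have rc x : `[< range c (Ordinal (cN x)) >] by apply/asboolP; exists x.
pose F x : color_system N (range c) (edge_color c) :=
  exist (fun i : 'I_N => `[< range c i >]) (Ordinal (cN x)) (rc x).
have sur a : exists2 x, F x = a & color_of a = c x.
  case: (a) => i ri; have /asboolP[x _ cx] := ri.
  by exists x => //; exact: color_of_inj.
exists F => //; split.
- apply/continuousP => O _.
  rewrite (_ : _ @^-1` _ = [set x | (color_of @` O) (c x)]).
    exact: coloring_open.
  apply/seteqP; split => x /=; first by exists (F x).
  by move=> [a Oa ac]; rewrite (_ : F x = a) //; exact: color_of_inj.
- by move=> a; have [x] := sur a; exists x.
- by move=> x x' xx'; exists x, x'.
- move=> a a' [x [x' [xa xa' xx']]].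
  by exists x, x'; split => //; exact: color_of_inj.
Qed.

(** * Extensibility versus universality with homogeneity *)

(** Let [C] and [D] be the quotients by [c] and [d], with targets [A0] and [B0]; halving induces [G]
    from [B0] to [A0]. Universality gives [K] from [U] to [B0], and homogeneity corrects it by an
    [H] with [G \o K \o H] equal to [C]. The colors of [K \o H] are the required refinement. *)
Lemma universal_extensible (U : Sys_ef) :
  universal all_systems U -> homogeneous finite_systems U ->
  extensible (sval U).
Proof.
move=> univ homog X c d colc cold cd.
have [N dN] := coloring_bounded (@system_compact X) cold.
have [M cM] := coloring_bounded (@system_compact (sval U)) colc.
have [u [u' uu']] := svalP U.
have [x [x' xx']] : nontrivial X.
  have : edge_color c (c u) (c u') by exists u, u'.
  by rewrite cd.2 => -[x [x' [_ _ xx']]]; exists x, x'.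
pose B0 := color_system N (range d) (edge_color d).
pose A0 := color_system M (range c) (edge_color c).
have [D qD DE] := color_system_quotient cold dN erefl erefl.
have [C qC CE] := color_system_quotient colc cM erefl erefl.
have ntB : nontrivial B0.
  by exists (D x), (D x'); case: qD => _ _ + _; apply.
have ntA : nontrivial A0.
  by exists (C u), (C u'); case: qC => _ _ + _; apply.
pose A : Sys_ef := exist _ A0 ntA; pose B : Sys_ef := exist _ B0 ntB.
have simB : similar c (half \o @color_of N (range d) (edge_color d)).
  apply: similar_trans cd _; have := quotient_similar (half \o color_of) qD.
  by congr similar; apply/funext => y; rewrite /= DE.
have bM (b : B0) : (half \o color_of) b < M.
  have : range (half \o @color_of N (range d) (edge_color d)) (half (color_of b)).
    by exists b.
  by rewrite -simB.1 => -[v _ /= <-].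
have colB : coloring (half \o @color_of N (range d) (edge_color d)).
  exact/coloring_comp/coloring_color_of.
have [G qG GE] := color_system_quotient colB bM (esym simB.1) (esym simB.2).
have [p] := univ B I; have [K [qK pE]] := @quotient_homP B U p.
have [] := homog A (@color_state_finite _ _) (@quotient_hom A U C qC)
  (comp (@quotient_hom B U K qK) (@quotient_hom A B G qG)).
move=> h _; have [H [qH ->]] := quotient_homP h.
rewrite !quotient_hom_comp => /eq_quotient_hom HE.
exists (color_of \o (K \o H)); split.
- apply: coloring_fun; last exact: coloring_color_of.
  by have [] := quotient_map_comp qH qK.
- apply: similar_trans (quotient_similar _ (quotient_map_comp qH qK)) _.
  apply: similar_sym; have := quotient_similar color_of qD.
  by congr similar; apply/funext => y; rewrite /= DE.
- by move=> v; rewrite /= -CE -HE /= GE.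
Qed.

Lemma extensible_unique (U V : Sys_ef) :
  extensible (sval U) -> extensible (sval V) -> isomorphic U V.
Proof.
move=> eU eV.
have [F [G [qF qG FK GK _]]] := extensible_iso eU eV (coloring_const _ 0)
  (coloring_const _ 0) (similar_const 0 (svalP U) (svalP V)).
(* Morphisms from [U] to [V] are quotient maps from [V] to [U], hence [G]. *)
exists (@quotient_hom U V G qG); exact: (is_iso_quotient qG qF GK FK).
Qed.

Lemma extensible_universal (U : Sys_ef) :
  extensible (sval U) -> universal all_systems U.
Proof.
move=> eU X _; have [F qF] := extensible_quotient eU (svalP U) (svalP X).
exact: (inhabits (quotient_hom qF)).
Qed.

Lemma finite_system_coloring (A : system) : finite_set [set: A] ->
  exists2 c : A -> nat, coloring c & injective c.
Proof.
move=> fA; have /countable_injP[c cinj] := finite_set_countable fA.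
exists c; last by move=> x y; apply: cinj; rewrite inE.
move=> n; rewrite -closedC; apply: (iffLR (@accessible_finite_set_closed A)).
  exact: hausdorff_accessible (@system_hausdorff A).
exact: sub_finite_set fA.
Qed.

(** An injective coloring of [A] pulls back along the two quotient maps to similar colorings of [U].
    An automorphism matching these colors matches the maps themselves. *)
Lemma extensible_homogeneous (U : Sys_ef) :
  extensible (sval U) -> homogeneous finite_systems U.
Proof.
move=> eU A fA f g; have [c cc cinj] := finite_system_coloring fA.
have [F [qF ->]] := quotient_homP f; have [G [qG ->]] := quotient_homP g.
have cF : coloring (c \o F) by apply: coloring_fun cc; case: qF.
have cG : coloring (c \o G) by apply: coloring_fun cc; case: qG.
have FG : similar (c \o F) (c \o G).
  apply: similar_trans (quotient_similar c qF) _.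
  exact/similar_sym/quotient_similar.
have [H [K [qH qK HK KH HE]]] := extensible_iso eU eU cF cG FG.
exists (@quotient_hom U U H qH); first exact: (is_iso_quotient qH qK).
rewrite quotient_hom_comp; apply/eq_quotient_hom => u.
exact/cinj/HE.
Qed.

(** * The explicit limit *)

Definition agree (n : nat) (x y : cantor_space) := forall k, k < n -> x k = y k.

Lemma agree_sym n x y : agree n x y -> agree n y x.
Proof. by move=> xy k /xy. Qed.

Lemma agree_trans n x y z : agree n x y -> agree n y z -> agree n x z.
Proof. by move=> xy yz k kn; rewrite xy ?yz. Qed.

Lemma agreeW m n x y : m <= n -> agree n x y -> agree m x y.
Proof. by move=> mn xy k km; apply: xy; exact: leq_trans km mn. Qed.

Lemma agree_open n x : open (agree n x).
Proof.
elim: n => [|n IH].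
  by rewrite (_ : agree 0 x = setT); [exact: openT|apply/seteqP; split].
have -> : agree n.+1 x = agree n x `&` (fun y : cantor_space => y n) @^-1` [set x n].
  apply/seteqP; split => y.
    by move=> xy; split; [exact: agreeW xy|rewrite /= xy].
  move=> [xy /= yn] k; rewrite ltnS leq_eqVlt => /predU1P[->//|]; exact: xy.
apply: openI => //; have /continuousP : continuous (fun y : cantor_space => y n).
  exact: (@proj_continuous _ (fun=> bool) n).
by apply; exact: discrete_open.
Qed.

Lemma agree_saturated_open n (A : set cantor_space) :
  (forall x y, agree n x y -> A x -> A y) -> open A.
Proof.
move=> sA; rewrite openE => x Ax; rewrite /interior nbhsE.
by exists (agree n x); [split; [exact: agree_open|]|move=> y xy; exact: sA xy Ax].
Qed.

Lemma agree_saturated_closed n (A : set cantor_space) :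
  (forall x y, agree n x y -> A x -> A y) -> closed A.
Proof.
move=> sA; rewrite -openC; apply: (@agree_saturated_open n) => x y xy nAx Ay.
by apply: nAx; apply: sA Ay; exact: agree_sym.
Qed.

Lemma agree_coloring n (c : cantor_space -> nat) :
  (forall x y, agree n x y -> c x = c y) -> coloring c.
Proof. by move=> cP m; apply: (@agree_saturated_open n) => x y /cP /= ->. Qed.

Lemma nbhs_agree (x : cantor_space) (O : set cantor_space) :
  nbhs x O -> exists n, agree n x `<=` O.
Proof.
rewrite nbhsE => -[V [oV Vx] VO]; apply: contrapT => nO.
have [|||y yP] := @compact_nested cantor_space (fun n => agree n x `&` ~` V)
  cantor_space_compact.
- move=> n; apply: closedI; last exact: open_closedC.
  apply: (@agree_saturated_closed n) => y z yz xy k kn.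
  by rewrite xy // yz.
- by move=> n y [xy ?]; split => //; exact: agreeW xy.
- move=> n; apply: contrapT => emp; apply: nO; exists n => y xy.
  by apply: VO; apply: contrapT => Vy; apply: emp; exists y.
- have [_ Vy] := yP 0; apply: Vy; rewrite (_ : y = x) //; apply/funext => k.
  by have [/(_ k) <-] := yP k.+1.
Qed.

(** Uniform continuity: otherwise compactness yields a point none of whose cylinders is
    monochromatic, although its color class is open. *)
Lemma coloring_agree (c : cantor_space -> nat) : coloring c ->
  exists n, forall x y, agree n x y -> c x = c y.
Proof.
move=> cc; apply: contrapT => nc.
have [|||x xP] := @compact_nested cantor_space
    (fun n => [set x | exists2 y, agree n x y & c x <> c y])
    cantor_space_compact.
- move=> n; rewrite -openC; apply: (@agree_saturated_open n) => x y xy /= nx.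
  move=> [z yz yzc]; have xz : agree n x z by move=> k kn; rewrite xy // yz.
  apply: yzc; apply: contrapT => yz'; apply: nx.
  (* Since [y] and [z] have different colors, one of them differs in color from [x]. *)
  have [xyc|nxy] := eqVneq (c x) (c y); first by exists z; rewrite ?xyc.
  by exists y => //; exact/eqP.
- by move=> n x [y xy ?]; exists y => //; exact: agreeW xy.
- move=> n; apply: contrapT => emp; apply: nc; exists n => x y xy.
  by apply: contrapT => cxy; apply: emp; exists x, y.
- have [n nP] : exists n, agree n x `<=` [set y | c y = c x].
    by apply: nbhs_agree; apply: open_nbhs_nbhs; split => //; exact: cc.
  by have [y /nP ->] := xP n.
Qed.

Lemma cantor_basis : basis (range (fun p : cantor_space * nat => agree p.2 p.1)).
Proof.
split=> [_ [p _ <-]|x O /nbhs_agree[n nO]]; first exact: agree_open.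
by exists (agree n x) => //; split => //; exists (x, n).
Qed.

Lemma cantor_clopen_basis : has_clopen_basis cantor_space.
Proof.
exists (range (fun p : cantor_space * nat => agree p.2 p.1)).
  exact: cantor_basis.
move=> _ [[x n] _ <-]; split; first exact: agree_open.
apply: (@agree_saturated_closed n) => y z yz xy k kn.
by rewrite xy // yz.
Qed.

Lemma cantor_second_countable : @second_countable cantor_space.
Proof.
exists (range (fun p : cantor_space * nat => agree p.2 p.1)); last exact: cantor_basis.
(* Every cylinder is given by a finite binary word, and there are countably many of these. *)
pose C (s : seq bool) : set cantor_space := agree (size s) (fun k => nth false s k).
apply: (@sub_countable _ _ _ (range C)); last first.
  exact: sub_countable (card_image_le C setT) (countableP _).
apply: subset_card_le => _ [[x n] _ <-]; exists (mkseq x n) => //.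
rewrite /C size_mkseq; apply/seteqP.
by split => y xy k kn; have := xy k kn; rewrite nth_mkseq.
Qed.

(* There is an edge from x to y iff x 0 = false, y 0 = true, x and y agree
   elsewhere, and both vanish at all positive even coordinates. *)
Definition generic_rel (k : nat) (a b : bool) :=
  if k == 0 then ~~ a && b else (a == b) && (a ==> odd k).

Definition generic_step : multifun cantor_space cantor_space :=
  fun x => [set y | forall k, generic_rel k (x k) (y k)].

Definition generic_upto (n : nat) : multifun cantor_space cantor_space :=
  fun x => [set y | forall k, k < n -> generic_rel k (x k) (y k)].

Lemma generic_upto_closed n x : closed (generic_upto n x).
Proof.
apply: (@agree_saturated_closed n) => y z yz xy k kn.
by rewrite -yz //; exact: xy.
Qed.

Lemma generic_step_closed : closed_valued generic_step.
Proof.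
move=> x; rewrite (_ : generic_step x = \bigcap_n generic_upto n x).
  by apply: closed_bigI => n _; exact: generic_upto_closed.
apply/seteqP; split => y; first by move=> xy n _ k _; exact: xy.
by move=> xy k; exact: (xy k.+1).
Qed.

Lemma generic_step_uhc : upper_hemicontinuous generic_step.
Proof.
move=> x V oV xV.
have [n nV] : exists n, generic_upto n x `<=` V.
  apply: contrapT => nV.
  have [|||y yP] := @compact_nested cantor_space
      (fun n => generic_upto n x `&` ~` V) cantor_space_compact.
  - move=> n; apply: closedI; last exact: open_closedC.
    exact: generic_upto_closed.
  - move=> n y [xy ?]; split => // k kn; apply: xy; exact: ltnW.
  - move=> n; apply: contrapT => emp; apply: nV; exists n => y xy.
    by apply: contrapT => Vy; apply: emp; exists y.
  - have [_] := yP 0; apply; apply: xV => k.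
    by have [xy _] := yP k.+1; exact: xy.
exists (agree n x); split => [||x' xx' y x'y]; first exact: agree_open.
  by [].
by apply: nV => k kn; rewrite xx' //; exact: x'y.
Qed.

Definition generic_system : system :=
  System cantor_clopen_basis cantor_second_countable cantor_space_compact
    cantor_space_hausdorff generic_step_closed generic_step_uhc.

(** Only the odd coordinates of [x] are kept: they parametrize the edges, [i] selecting source or
    target. *)
Definition endpoint (i : bool) (x : cantor_space) : cantor_space :=
  fun k => if k == 0 then i else odd k && x k.

Lemma endpoint_step x : step generic_system (endpoint false x) (endpoint true x).
Proof.
move=> k; rewrite /generic_rel /endpoint; case: eqP => // _.
by rewrite eqxx /=; case: (odd k); case: (x k).
Qed.

Lemma step_endpoint x y : step generic_system x y ->
  x = endpoint false x /\ y = endpoint true x.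
Proof.
move=> xy; split; apply/funext => k; have := xy k;
  rewrite /generic_rel /endpoint; case: eqP => [->|_].
- by case: (x 0).
- by case: (x k); case: (y k); case: (odd k).
- by case/andP.
- by case: (x k); case: (y k); case: (odd k).
Qed.

Lemma generic_nontrivial : nontrivial generic_system.
Proof.
by exists (endpoint false point), (endpoint true point); exact: endpoint_step.
Qed.

Lemma endpoint_agree n i x y : agree n x y -> agree n (endpoint i x) (endpoint i y).
Proof. by move=> xy k kn; rewrite /endpoint xy. Qed.

Lemma edge_color_generic (c : cantor_space -> nat) a b :
  @edge_color generic_system c a b <->
  exists x, c (endpoint false x) = a /\ c (endpoint true x) = b.
Proof.
split=> [[x [y [<- <- /step_endpoint[xE yE]]]]|[x [<- <-]]].
  by exists x; rewrite -xE -yE.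
by exists (endpoint false x), (endpoint true x); split => //; exact: endpoint_step.
Qed.

(* A clopen neighborhood of the set of endpoints. *)
Definition thin (n : nat) (x : cantor_space) :=
  all (fun k => x k ==> odd k) (iota 1 n).

Lemma thin_agree m n x y : n < m -> agree m x y -> thin n x = thin n y.
Proof.
move=> nm xy; apply: eq_in_all => k; rewrite mem_iota add1n => /andP[_ kn].
by rewrite xy //; exact: leq_trans kn nm.
Qed.

Lemma thin_endpoint n x : thin n x -> agree n.+1 x (endpoint (x 0) x).
Proof.
move=> /allP tx k kn; rewrite /endpoint; case: eqP => [->//|/eqP k0].
have /tx : k \in iota 1 n by rewrite mem_iota add1n lt0n k0.
by case: (x k) => /= [->|]; rewrite ?andbF.
Qed.

Lemma endpoint_thin n i x : thin n (endpoint i x).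
Proof.
apply/allP => k; rewrite mem_iota /endpoint => /andP[k0 _].
by case: eqP k0 => [->//|_ _]; case: (odd k); rewrite ?implybT.
Qed.

Lemma endpoint_endpoint i j x : endpoint i (endpoint j x) = endpoint i x.
Proof.
apply/funext => k; rewrite /endpoint; case: eqP => // _.
by case: (odd k).
Qed.

Definition update (x : cantor_space) (k : nat) (b : bool) : cantor_space :=
  fun j => if j == k then b else x j.

Lemma update_agree n x k b : n <= k -> agree n x (update x k b).
Proof.
move=> nk j jn; rewrite /update; case: eqP => // jk.
by move: nk; rewrite leqNgt -jk jn.
Qed.

Lemma double_half_odd n : n./2.*2 + odd n = n.
Proof. by rewrite addnC odd_double_half. Qed.

(** Near the endpoint sets the new color follows a lifted edge, elsewhere a lifted vertex. Spare
    coordinates select the lifts, so that all vertices and edges of the finer graph are realized. *)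
Lemma generic_extensible : extensible generic_system.
Proof.
move=> X c d colc cold [rcd ecd].
have [m0 m0P] := coloring_agree colc.
(* [N] is odd, so coordinates [N] and [N.+2] are free on endpoints and can select edge lifts, while
   a true value at the even coordinate [N.+1] excludes endpoints. *)
pose N := m0.*2.+1.
have cP x y : agree N x y -> c x = c y.
  by move=> xy; apply: m0P; apply: agreeW xy; rewrite /N -addnn ltnW // ltnS leq_addr.
pose a x := c (endpoint false x); pose b x := c (endpoint true x).
have aP x y : agree N x y -> a x = a y by move=> xy; exact/cP/endpoint_agree.
have bP x y : agree N x y -> b x = b y by move=> xy; exact/cP/endpoint_agree.
have /choice[L LP] : forall p : nat * nat, exists q : nat * nat,
    edge_color c p.1 p.2 -> [/\ edge_color d q.1 q.2, q.1./2 = p.1 & q.2./2 = p.2].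
  move=> p; have [|np] := pselect (edge_color c p.1 p.2); last by exists p.
  by rewrite ecd => -[x [y [<- <- xy]]]; exists (d x, d y) => _; split => //; exists x, y.
(* c only depends on the coordinates below N, so those above are free to choose
   the lifts: e x lifts the edge of colors (a x, b x), v x the vertex c x. *)
pose e1 x := ((a x).*2 + x N, (b x).*2 + x N.+2).
pose e x := if `[< edge_color d (e1 x).1 (e1 x).2 >] then e1 x else L (a x, b x).
have eP x : [/\ edge_color d (e x).1 (e x).2, (e x).1./2 = a x & (e x).2./2 = b x].
  rewrite /e; case: asboolP => [?|_]; first by split => //; exact: half_double_bit.
  by apply: (LP (a x, b x)); apply/edge_color_generic; exists x.
pose v1 x := (c x).*2 + x N.
(* At least one of the two lifts of [c x] is a color of [d]; if the one requested by the bit [x N]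
   is not, the other is. *)
pose v x := if `[< range d (v1 x) >] then v1 x else (c x).*2 + ~~ x N.
have vP x : range d (v x) /\ (v x)./2 = c x.
  split; last by rewrite /v; case: asboolP => _; exact: half_double_bit.
  rewrite /v; case: asboolP => // nv.
  have : range c (c x) by exists x.
  rewrite rcd => -[y _ /= yc]; exists y => //.
  have := double_half_odd (d y); rewrite yc.
  case: (odd (d y)) => dy; case xN: (x N) => //=.
  - by case: nv; exists y => //; rewrite /v1 xN.
  - by case: nv; exists y => //; rewrite /v1 xN.
pose f x := if thin N.+1 x then (if x 0 then (e x).2 else (e x).1) else v x.
have ltN : N < N.+3 by rewrite -addn3 -addn1 leq_add2l.
have eE x y : agree N.+3 x y -> e x = e y.
  move=> xy; have xyN : agree N x y by apply: agreeW xy; rewrite -addn3 leq_addr.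
  by rewrite /e /e1 (aP _ _ xyN) (bP _ _ xyN) !xy.
(* Both ends of an edge see the same lift, because the selecting coordinates are odd. *)
have e_endpoint i x : e (endpoint i x) = e x.
  rewrite /e /e1 /a /b !endpoint_endpoint.
  by rewrite /endpoint /N /= !odd_double.
have fa x : f (endpoint false x) = (e x).1.
  by rewrite /f endpoint_thin e_endpoint.
have fb x : f (endpoint true x) = (e x).2.
  by rewrite /f endpoint_thin e_endpoint.
exists f; split.
- apply: (@agree_coloring N.+3) => x y xy.
  have xyN : agree N x y by apply: agreeW xy; rewrite -addn3 leq_addr.
  by rewrite /f (thin_agree _ xy) // xy // (eE _ _ xy) /v /v1 (cP _ _ xyN) xy.
- split.
    apply/seteqP; split => n.
      move=> [x _ <-]; rewrite /f; case: ifP => _; last by case: (vP x).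
      have [[y [y' [yE y'E _]]] _ _] := eP x.
      by case: ifP => _; [exists y'|exists y].
    move=> [y _ yn]; have : range (half \o d) n./2 by exists y; rewrite //= yn.
    rewrite -rcd => -[x _ xn].
    (* Coordinate [N] requests the lift [n]; coordinate [N.+1] makes [z] fail [thin], so that [f z]
       is [v z]. *)
    pose z := update (update x N (odd n)) N.+1 true.
    have xz : agree N x z.
      by apply: (agree_trans (update_agree _ _ (leqnn N))); exact: update_agree.
    exists z => //; rewrite /f (_ : thin _ z = false); last first.
      apply/negP => /allP /(_ N.+1); rewrite mem_iota add1n !ltnS leqnn.
      by rewrite /z /update eqxx /= odd_double => /(_ isT).
    have v1z : v1 z = n.
      rewrite /v1 -(cP _ _ xz) xn /z /update eqxx ltn_eqF //.
      exact: double_half_odd.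
    by rewrite /v v1z (asboolT _) //; exists y.
- apply/funext => p; apply/funext => q; apply/propext; split.
    move=> /edge_color_generic[x [<- <-]]; rewrite fa fb.
    by have [] := eP x.
  move=> pq; have : edge_color (half \o d) p./2 q./2.
    by have [y [y' [<- <- yy']]] := pq; exists y, y'.
  rewrite -ecd => /edge_color_generic[x [xp xq]].
  apply/edge_color_generic.
  (* The two odd coordinates request the parities of [p] and [q] independently. *)
  pose z := update (update x N (odd p)) N.+2 (odd q).
  have xz : agree N x z.
    apply: (agree_trans (update_agree _ _ (leqnn N))).
    by apply: update_agree; rewrite -addn2 leq_addr.
  have e1z : e1 z = (p, q).
    rewrite /e1 -(aP _ _ xz) -(bP _ _ xz) /a /b xp xq /z /update !eqxx.
    by rewrite ltn_eqF // !double_half_odd.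
  by exists z; rewrite fa fb /e e1z (asboolT _).
- move=> x; rewrite /f; case: ifP => tx; last by case: (vP x).
  (* A thin point agrees with its endpoint beyond the coordinates [c] depends on, so its old color
     is [a x] or [b x] according to [x 0]. *)
  have cx : c x = c (endpoint (x 0) x).
    by apply: cP; apply: agreeW (thin_endpoint tx); rewrite -addn2 leq_addr.
  have [_ ea eb] := eP x.
  by rewrite cx; case: (x 0); rewrite ?ea ?eb.
Qed.

Theorem theorem4p2 :
  exists U : Sys_ef,
    (universal all_systems U /\ homogeneous finite_systems U) /\
    forall V : Sys_ef,
      universal all_systems V /\ homogeneous finite_systems V ->
      isomorphic U V.
Proof.
pose U : Sys_ef := exist _ generic_system generic_nontrivial.
exists U; split=> [|V [uV hV]].
  split; first exact: (@extensible_universal U generic_extensible).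
  exact: (@extensible_homogeneous U generic_extensible).
exact: (@extensible_unique U V generic_extensible (universal_extensible uV hV)).
Qed.
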